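(* For every $n\ge 1$ and every $t$ in $J$, $$L_n(t)=\frac1N\sum_{j=1}^{n}\frac{j}{N}\,\frac{d^2}{dt^2}\log L_{n-j}(t),$$ where the $j=n$ term uses $\log L_0(t)=NF(t)$.
   Context: Let $N>0$ be a fixed parameter. Let $\rho$ be a positive Borel measure on $\mathbb R$ with infinite support such that $M(t):=\int_{\mathbb R}e^{tN\epsilon}\,d\rho(\epsilon)$ is finite for all $t$ in an open interval $J$. Write $M(t)=\exp(NF(t))$. For $n\ge 0$ let $\Delta_n(t)=\det\big[M^{(i+j-2)}(t)\big]_{i,j=1}^{n+1}$ be the Hankel determinant of the derivatives of $M$, and set $\Delta_{-1}:=1$; these satisfy $\Delta_n(t)>0$. The Lanczos $L$-functions are defined by $L_0(t)=M(t)$ and, for $n\ge1$, $N^2L_n(t)=\Delta_n(t)\Delta_{n-2}(t)/\Delta_{n-1}(t)^2$. *)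

(* Defs.v *)
From HB Require Import structures.
From mathcomp Require Import all_boot all_order all_algebra.
From mathcomp Require Import all_classical all_reals all_analysis.
Set Implicit Arguments. Unset Strict Implicit. Unset Printing Implicit Defensive.
Import Order.TTheory GRing.Theory Num.Theory.
Import numFieldNormedType.Exports.
Local Open Scope classical_set_scope.
Local Open Scope ring_scope.

Section Lanczos.
Variable R : realType.

Definition msupport (rho : {measure set R -> \bar R}) : set R :=
  [set x | forall e : R, 0 < e -> (0 < rho (ball x e))%E].

(* M(t) = \int e^{t N eps} d rho(eps)  (real value; meaningful where finite) *)
Definition mgfM (N : R) (rho : {measure set R -> \bar R}) (t : R) : R :=
  fine (\int[rho]_x (expR (t * N * x))%:E).

(* hankelDet k t = det [M^{(i+j)}(t)]_{i,j<k};  Delta_n = hankelDet (n+1), Delta_{-1} = hankelDet 0 = 1 *)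
Definition hankelDet (M : R -> R) (k : nat) (t : R) : R :=
  \det (\matrix_(i < k, j < k) (derive1n (i + j)%N M) t).

(* Lanczos L-functions: L_0 = M, N^2 L_n = Delta_n Delta_{n-2} / Delta_{n-1}^2 *)
Definition lanczosL (N : R) (M : R -> R) (n : nat) (t : R) : R :=
  match n with
  | 0%N => M t
  | m.+1 => hankelDet M m.+2 t * hankelDet M m t / (hankelDet M m.+1 t ^+ 2) / N ^+ 2
  end.

End Lanczos.

(* Main.v *)
(* Since Delta_n is the Hankel determinant of the derivatives of M, Delta_n' and
   Delta_n'' are the determinants obtained by shifting the last row, respectively
   the last row and the last column, by one. The Desnanot-Jacobi identity then
   gives the Toda equation
   (log Delta_n)'' = Delta_(n+1) Delta_(n-1) / Delta_n^2 = N^2 L_(n+1).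
   As log L_k is, up to a constant, the second difference of k |-> log Delta_(k-1),
   summing twice gives the formula. Taking logarithms requires Delta_n > 0: the
   Hankel matrix is the Gram matrix of the monomials for the measure
   e^(tN eps) d rho, and a nonzero polynomial has too few roots to vanish on the
   infinite support of rho. *)
Require Import Defs.
From HB Require Import structures.
From mathcomp Require Import all_boot all_order all_algebra.
From mathcomp Require Import all_classical all_reals all_analysis.
From mathcomp Require Import perm measurable_realfun ring lra.
Import Order.TTheory GRing.Theory Num.Theory.
Import numFieldNormedType.Exports.
Local Open Scope classical_set_scope.
Local Open Scope ring_scope.

(** * Hankel minors and the Desnanot-Jacobi identity *)

Lemma det_block_schur (F : fieldType) (n p : nat) (P : 'M[F]_n) (Q : 'M[F]_(n, p))
    (S : 'M[F]_(p, n)) (T : 'M[F]_p) :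
  P \in unitmx ->
  \det (block_mx P Q S T) = \det P * \det (T - S *m invmx P *m Q).
Proof.
move=> uP.
have -> : block_mx P Q S T =
    block_mx 1%:M 0 (S *m invmx P) 1%:M *m block_mx P Q 0 (T - S *m invmx P *m Q).
  rewrite mulmx_block !mul1mx !mul0mx !addr0 ?mulmx0 ?addr0 mulmxKV//.
  by rewrite addrCA subrr addr0.
by rewrite det_mulmx det_lblock det_ublock !det1 !mul1r.
Qed.

(** [r] and [c] list the row and column indices, so that the minors with a shifted last row or
    column, which arise on differentiating, have the same form as the Hankel determinant itself
    ([r = c = id]). *)
Definition hdet {R : comNzRingType} (m : nat -> R) (r c : nat -> nat) (k : nat) : R :=
  \det (\matrix_(i < k, j < k) m (r i + c j)%N).

Definition bump_last (n u i : nat) : nat := if i == n then u else i.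

Lemma hdet_sym (R : comNzRingType) (m : nat -> R) (r c : nat -> nat) (k : nat) :
  hdet m r c k = hdet m c r k.
Proof.
rewrite /hdet -det_tr; congr (\det _); apply/matrixP => i j.
by rewrite !mxE addnC.
Qed.

Lemma eq_hdet (R : comNzRingType) (m : nat -> R) (r r' c c' : nat -> nat) (k : nat) :
  (forall i, (i < k)%N -> r i = r' i) -> (forall i, (i < k)%N -> c i = c' i) ->
  hdet m r c k = hdet m r' c' k.
Proof.
move=> rr cc; congr (\det _); apply/matrixP => i j.
by rewrite !mxE rr// cc.
Qed.

(** Each minor of size [n.+1] is [\det P] times an entry of the Schur complement of [P], and the
    determinant of size [n.+2] is [\det P] times the 2 by 2 determinant of these entries. *)
Lemma desnanot_jacobi_hankel (F : fieldType) (m : nat -> F) (n : nat) :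
  hdet m id id n != 0 ->
  hdet m id id n.+2 * hdet m id id n =
    hdet m id id n.+1 * hdet m (bump_last n n.+1) (bump_last n n.+1) n.+1
    - hdet m (bump_last n n.+1) id n.+1 ^+ 2.
Proof.
set P := \matrix_(i < n, j < n) m (i + j)%N => P0.
have uP : P \in unitmx by rewrite unitmxE unitfE.
pose s u v := m (u + v)%N -
  ((\row_j m (u + j)%N) *m invmx P *m (\col_i m (i + v)%N)) 0 0.
have bordered u v : hdet m (bump_last n u) (bump_last n v) n.+1 = \det P * s u v.
  rewrite -addn1 /hdet.
  have -> : (\matrix_(i < n + 1, j < n + 1)
      m (bump_last n u i + bump_last n v j)%N) =
      block_mx P (\col_i m (i + v)%N) (\row_j m (u + j)%N) (m (u + v)%N)%:M.
    apply/matrixP => i j; rewrite !mxE /bump_last.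
    case: splitP => i' ->; rewrite mxE; case: splitP => j' ->; rewrite !mxE.
    - by rewrite !ltn_eqF.
    - by rewrite !ord1 addn0 eqxx ltn_eqF.
    - by rewrite !ord1 addn0 eqxx ltn_eqF.
    - by rewrite !ord1 addn0 !eqxx.
  rewrite det_block_schur// det_mx11; congr (_ * _).
  by rewrite mxE [in LHS]mxE/= /s mulr1n [X in _ + X]mxE.
have id_last : forall k, (k < n.+1)%N -> id k = bump_last n n k.
  by move=> k _; rewrite /bump_last; case: eqP.
have E1 : hdet m id id n.+1 = \det P * s n n.
  by rewrite -bordered; exact: eq_hdet.
have E2 : hdet m (bump_last n n.+1) id n.+1 = \det P * s n.+1 n.
  by rewrite -bordered; exact: eq_hdet.
(* The minor of [E2], transposed: Hankel symmetry makes the two off-diagonal entries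
   interchangeable, whence the square. *)
have E3 : hdet m (bump_last n n.+1) id n.+1 = \det P * s n n.+1.
  by rewrite -bordered hdet_sym; exact: eq_hdet.
have E4 : hdet m id id n.+2 =
    \det P * (s n n * s n.+1 n.+1 - s n n.+1 * s n.+1 n).
  rewrite -addn2 /hdet.
  have -> : (\matrix_(i < n + 2, j < n + 2) m (id i + id j)%N) =
      block_mx P (\matrix_(i < n, l < 2) m (i + (n + l))%N)
       (\matrix_(k < 2, j < n) m (n + k + j)%N)
       (\matrix_(k < 2, l < 2) m (n + k + (n + l))%N).
    apply/matrixP => i j; rewrite !mxE.
    by case: splitP => i' ->; rewrite mxE; case: splitP => j' ->; rewrite !mxE.
  rewrite det_block_schur//; congr (_ * _).
  set X := _ - _.
  have XE k l : X k l = s (n + k)%N (n + l)%N.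
    rewrite /X mxE [in LHS]mxE [X in _ + X]mxE /s; congr (_ - _).
    rewrite !mxE; apply: eq_bigr => i _; rewrite !mxE; congr (_ * _).
    by apply: eq_bigr => j _; rewrite !mxE.
  clearbody X; rewrite (expand_det_row _ 0) !big_ord_recl big_ord0 addr0.
  rewrite /cofactor !det_mx11.
  rewrite !mxE !XE /= /bump /= !addn0 !addn1 expr0 expr1 mul1r mulN1r mulrN.
  by [].
have E0 : hdet m id id n = \det P by [].
by rewrite expr2 {1}E2 E3 E4 E1 bordered E0; ring.
Qed.

(** * Positivity from positive definiteness *)

Lemma hdet_gt0 (R : realFieldType) (m : nat -> R) :
  (forall k (v : 'cV[R]_k), v != 0 ->
     0 < (v^T *m (\matrix_(i < k, j < k) m (i + j)%N) *m v) 0 0) ->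
  forall k, 0 < hdet m id id k.
Proof.
move=> pos; elim=> [|k IH]; first by rewrite /hdet det_mx00.
(* Pairing with the last column [v] of the adjugate gives
   [det H_(k+1) * det H_k = v^T H v]. *)
pose H := \matrix_(i < k.+1, j < k.+1) m (i + j)%N.
pose v := col ord_max (\adj H).
(* The last entry of [v] is the corner cofactor, positive by induction; hence [v] is nonzero. *)
have vmax : v ord_max 0 = hdet m id id k.
  rewrite !mxE /cofactor -signr_odd oddD addbb expr0 mul1r.
  congr (\det _); apply/matrixP => i j; rewrite !mxE.
  by rewrite !lift_max.
have v0 : v != 0.
  apply/eqP => /matrixP/(_ ord_max 0); rewrite vmax mxE => e.
  by rewrite e ltxx in IH.
have := pos _ v v0.
rewrite -/H -mulmxA [X in _ *m (_ *m X)]colE [H *m _]mulmxA mul_mx_adj.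
rewrite mul_scalar_mx -scalemxAr -colE mxE [X in _ * X]mxE [X in _ * X]mxE vmax.
by rewrite pmulr_lgt0.
Qed.

(** * Derivatives of determinants *)

Lemma is_derive_prod (R : realType) (n : nat) (t : R) (f : 'I_n -> R -> R)
    (df : 'I_n -> R) :
  (forall i, is_derive t 1 (f i) (df i)) ->
  is_derive t 1 (fun s => \prod_(i < n) f i s)
    (\sum_(k < n) \prod_(i < n) if i == k then df i else f i t).
Proof.
elim: n f df => [|n IH] f df fdf.
  rewrite big_ord0.
  have -> : (fun s => \prod_(i < 0) f i s) = cst 1.
    by apply/funext => s; rewrite big_ord0.
  exact: is_derive_cst.
have -> : (fun s => \prod_(i < n.+1) f i s) =
    f ord0 * (fun s => \prod_(i < n) f (lift ord0 i) s).
  by apply/funext => s; rewrite big_ord_recl.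
have {}IH := IH _ _ (fun i => fdf (lift ord0 i)).
apply: is_derive_eq; rewrite big_ord_recl addrC; congr (_ + _).
  by rewrite big_ord_recl eqxx /= /GRing.scale/= mulrC; congr (_ * _).
rewrite /GRing.scale/= big_distrr/=; apply: eq_bigr => k _.
by rewrite big_ord_recl/=; congr (_ * _).
Qed.

(** Each term of the Leibniz expansion is differentiated one factor at a time; exchanging the sums
    over permutations and rows collects determinants with one row differentiated. *)
Lemma is_derive_det (R : realType) (n : nat) (t : R) (A : 'I_n -> 'I_n -> R -> R)
    (dA : 'I_n -> 'I_n -> R) :
  (forall i j, is_derive t 1 (A i j) (dA i j)) ->
  is_derive t 1 (fun s => \det (\matrix_(i, j) A i j s))
    (\sum_k \det (\matrix_(i, j) if i == k then dA i j else A i j t)).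
Proof.
move=> AdA.
have -> : (fun s => \det (\matrix_(i, j) A i j s)) =
    \sum_(p : 'S_n) ((-1) ^+ p \*: (fun s => \prod_i A i (p i) s)).
  apply/funext => s; rewrite fct_sumE; apply: eq_bigr => p _.
  by congr (_ * _); apply: eq_bigr => i _; rewrite mxE.
have -> : \sum_k \det (\matrix_(i, j) if i == k then dA i j else A i j t) =
    \sum_(p : 'S_n) (-1) ^+ p *:
      \sum_k \prod_i if i == k then dA i (p i) else A i (p i) t.
  under [RHS]eq_bigr do rewrite scaler_sumr.
  rewrite exchange_big/=; apply: eq_bigr => k _; apply: eq_bigr => p _.
  by congr (_ * _); apply: eq_bigr => i _; rewrite mxE.
elim/big_ind2 : _ => [|x u y v xu yv|p _]; first exact: is_derive_cst.
  exact: is_deriveD.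
apply: is_deriveZ; apply: is_derive_prod => i; exact: AdA.
Qed.

(* Differentiating row [i < n] turns it into a copy of row [i + 1], so only the
   last row contributes. *)
Lemma is_derive_hdet (R : realType) (m : nat -> R -> R) (t : R)
    (c : nat -> nat) (n : nat) :
  (forall k, is_derive t 1 (m k) (m k.+1 t)) ->
  is_derive t 1 (fun s => hdet (m ^~ s) id c n.+1)
    (hdet (m ^~ t) (bump_last n n.+1) c n.+1).
Proof.
move=> dm.
have := @is_derive_det R n.+1 t (fun i j => m (i + c j)%N)
  (fun i j => m (i + c j).+1 t) (fun i j => dm _).
move=> /(is_derive_eq (df := _)); apply.
rewrite /hdet big_ord_recr big1 => [|k _].
  rewrite /= add0r; congr (\det _); apply/matrixP => i j; rewrite !mxE /bump_last.
  by rewrite -val_eqE/=; case: eqP => // ->.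
pose k' := lift ord0 k.
have kk' : widen_ord (leqnSn n) k != k'.
  by rewrite -val_eqE /= /bump /= neq_ltn ltnSn.
apply: (determinant_alternate kk') => j; rewrite !mxE eqxx eq_sym (negbTE kk').
by rewrite /k' lift0 addSn.
Qed.

(** * Second derivatives on an open set *)

(** The first derivative is kept as a witness on all of [J], so that linear combinations can be
    formed before passing to [derive1n 2]. *)
Definition second_derivative_on {R : realType} (J : set R) (g d : R -> R) : Prop :=
  exists g1 : R -> R, forall s, J s -> is_derive s 1 g (g1 s) /\ is_derive s 1 g1 (d s).

Section second_derivative_on.
Context {R : realType} (J : set R).
Hypothesis openJ : open J.
Implicit Types g h d e : R -> R.

Lemma second_derivative_onP g d t :
  second_derivative_on J g d -> J t -> derive1n 2 g t = d t.
Proof.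
move=> [g1 gd] Jt; have [_ g1d] := gd t Jt.
rewrite derive1nS derive1n1 derive1E -[RHS](@derive_val _ _ _ _ _ _ _ g1d).
(* As [J] is open, the derivative of [g] equals [g1] near [t], so both have the same derivative at
   [t]. *)
apply: near_eq_derive; near=> s.
have /gd[g1s _] : J s by near: s; exact: open_nbhs_nbhs.
by rewrite derive1E derive_val.
Unshelve. all: by end_near. Qed.

Lemma eq_second_derivative_on g h d :
  (forall s, J s -> g s = h s) ->
  second_derivative_on J g d -> second_derivative_on J h d.
Proof.
move=> gh [g1 gd]; exists g1 => s Js; split; last exact: (gd s Js).2.
apply: near_eq_is_derive (gd s Js).1; near=> u; apply: gh.
by near: u; exact: open_nbhs_nbhs.
Unshelve. all: by end_near. Qed.

Lemma second_derivative_on_cst c : second_derivative_on J (cst c) (cst 0).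
Proof. by exists (cst 0) => s _; split; exact: is_derive_cst. Qed.

Lemma second_derivative_onD g h d e :
  second_derivative_on J g d -> second_derivative_on J h e ->
  second_derivative_on J (g + h) (d + e).
Proof.
move=> [g1 gd] [h1 he]; exists (g1 + h1) => s Js.
have [? ?] := gd s Js; have [? ?] := he s Js.
by split; exact: is_deriveD.
Qed.

Lemma second_derivative_onZ a g d :
  second_derivative_on J g d -> second_derivative_on J (a \*: g) (a \*: d).
Proof.
move=> [g1 gd]; exists (a \*: g1) => s Js.
have [? ?] := gd s Js.
by split; exact: is_deriveZ.
Qed.

Lemma second_derivative_on_ln g g1 g2 :
  (forall s, J s -> 0 < g s) ->
  (forall s, J s -> is_derive s 1 g (g1 s) /\ is_derive s 1 g1 (g2 s)) ->
  second_derivative_on J (@ln R \o g) (fun s => (g s * g2 s - g1 s ^+ 2) / g s ^+ 2).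
Proof.
move=> g0 gd; exists (fun s => (g s)^-1 * g1 s) => s Js.
have [dg dg1] := gd s Js; have gs := g0 s Js.
have gs0 : g s != 0 by rewrite gt_eqF.
split; first by apply: is_derive1_comp; exact: is_derive1_ln.
have dV := is_deriveV gs0 dg.
have := is_deriveM dV dg1.
move=> /(is_derive_eq (df := _)); apply; rewrite /GRing.scale/=.
by field.
Qed.

End second_derivative_on.

(** * The Toda equation and its double summation *)

Lemma toda_hankel (R : realType) (J : set R) (m : nat -> R -> R) (n : nat) :
  (forall k s, J s -> is_derive s 1 (m k) (m k.+1 s)) ->
  (forall k s, J s -> 0 < hdet (m ^~ s) id id k) ->
  second_derivative_on J (@ln R \o (fun s => hdet (m ^~ s) id id n.+1))
    (fun s => hdet (m ^~ s) id id n.+2 * hdet (m ^~ s) id id n /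
              hdet (m ^~ s) id id n.+1 ^+ 2).
Proof.
move=> dm pos.
pose D1 s := hdet (m ^~ s) (bump_last n n.+1) id n.+1.
pose D2 s := hdet (m ^~ s) (bump_last n n.+1) (bump_last n n.+1) n.+1.
have [||g1 gd] := second_derivative_on_ln J (fun s => hdet (m ^~ s) id id n.+1) D1 D2.
- by move=> s; exact: pos.
- move=> s Js; have dms k := dm k s Js.
  split; first exact: is_derive_hdet.
  (* By symmetry [D1] is also the determinant with shifted last column; differentiating its rows
     then shifts the last row as well. *)
  have := is_derive_hdet R m s (bump_last n n.+1) n dms.
  by under eq_fun do rewrite hdet_sym.
exists g1 => s Js; have := gd s Js.
rewrite -desnanot_jacobi_hankel//; last by rewrite gt_eqF// pos.
Qed.

Lemma lanczos_toda (R : realType) (J : set R) (m : nat -> R -> R) (N : R) (n : nat) t :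
  0 < N -> open J ->
  (forall k s, J s -> is_derive s 1 (m k) (m k.+1 s)) ->
  (forall k s, J s -> 0 < hdet (m ^~ s) id id k) ->
  (forall k s, J s -> derive1n k (m 0%N) s = m k s) ->
  J t -> (1 <= n)%N ->
  lanczosL N (m 0%N) n t =
      N^-1 * \sum_(1 <= j < n.+1)
               ((j%:R / N) * derive1n 2 ((@ln R) \o lanczosL N (m 0%N) (n - j)%N) t).
Proof.
move=> N0 oJ dm pos Mm Jt n1.
(* [D k] is Delta_(k-1), and [d k] is the second derivative of its logarithm; [d 0] vanishes because
   [D 0] is 1. *)
pose D k s := hdet (m ^~ s) id id k.
pose d k s := if k is l.+1 then D l.+2 s * D l s / D l.+1 s ^+ 2 else 0.
have DE k s : J s -> hankelDet (m 0%N) k s = D k s.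
  move=> Js; rewrite /hankelDet /D /hdet; congr (\det _).
  by apply/matrixP => i j; rewrite !mxE Mm.
have lnD k : second_derivative_on J (@ln R \o D k) (d k).
  case: k => [|k]; last exact: toda_hankel.
  apply: (eq_second_derivative_on _ _ (cst 0)) => //;
    last exact: second_derivative_on_cst.
  by move=> s _; rewrite /= /D /hdet det_mx00 ln1.
(* The second derivative of log L_k: a second difference of [d], the factor N^-2 adding only a
   constant to the logarithm. At the boundary L_0 is [D 1], without a difference. *)
pose l k s := if k is i.+1 then d i.+2 s + d i s - 2 * d i.+1 s else d 1 s.
have lnL k : second_derivative_on J (@ln R \o lanczosL N (m 0%N) k) (l k).
  case: k => [|k].
    apply: (eq_second_derivative_on _ _ (@ln R \o D 1)) => //.
    by move=> s _; rewrite /= /D /hdet det_mx11 mxE.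
  apply: (eq_second_derivative_on _ _ ((@ln R \o D k.+2) + (@ln R \o D k)
     + (-2) \*: (@ln R \o D k.+1) + cst (- ln (N ^+ 2)))) => //.
    move=> s Js; rewrite /= !DE//.
    have p i := pos i s Js.
    rewrite ln_div ?posrE ?divr_gt0 ?mulr_gt0 ?exprn_gt0//; try exact: p.
    rewrite ln_div ?posrE ?mulr_gt0 ?exprn_gt0//; try exact: p.
    rewrite lnM ?posrE//; try exact: p.
    rewrite !(lnXn 2) ?posrE//; try exact: p.
    by rewrite !fctE /= /GRing.scale/=; ring.
  have -> : l k.+1 = d k.+2 + d k + (-2) \*: d k.+1 + cst 0.
    by apply/funext => s; rewrite /l !fctE /= /GRing.scale/=; ring.
  apply: second_derivative_onD; last exact: second_derivative_on_cst.
  apply: second_derivative_onD; last exact: second_derivative_onZ.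
  by apply: second_derivative_onD.
(* Induction on [n]: raising [n] by one adds the unweighted sum of [l], which telescopes to
   [d n.+1 - d n]. *)
have sumE : \sum_(1 <= j < n.+1) (j%:R * l (n - j)%N t) = d n t.
  clear n1; elim: n => [|n IH]; first by rewrite big_geq.
  have sum_l : \sum_(0 <= i < n.+1) l i t = d n.+1 t - d n t.
    clear IH; elim: n => [|n IH]; first by rewrite big_nat1 subr0.
    by rewrite big_nat_recr// IH /=; ring.
  rewrite big_add1 /=.
  under eq_bigr do rewrite subSS -natr1 mulrDl mul1r.
  rewrite big_split/= big_nat_recl// mul0r add0r.
  rewrite big_add1 /= in IH; rewrite IH.
  by rewrite big_nat_rev/= in sum_l; rewrite sum_l addrC subrK.
under eq_bigr do rewrite (second_derivative_onP J oJ _ _ _ (lnL _) Jt) mulrAC.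
rewrite -mulr_suml sumE.
(* For a positive index, [d n] is N^2 L_n by the Toda equation, which absorbs the two factors
   1/N. *)
case: n n1 sumE => // n _ _.
by rewrite /= !DE//; field; rewrite !gt_eqF//; exact: pos.
Qed.

(** * Exponential moments and differentiation under the integral *)

(** A bound uniform in [s]: one term of the exponential series absorbs the power into exp(e|y|),
    replacing [s] by [t] costs another e|y|, and the sign of [y] decides which exponential on the
    right dominates. *)
Lemma exprn_mul_expR_le (R : realType) (k : nat) (e t s y : R) :
  0 < e -> `|s - t| <= e ->
  `|y ^+ k * expR (s * y)| <=
    k`!%:R / e ^+ k * (expR ((t + 2 * e) * y) + expR ((t - 2 * e) * y)).
Proof.
move=> e0 ste.
have pow_le : `|y| ^+ k <= k`!%:R / e ^+ k * expR (e * `|y|).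
  rewrite mulrAC ler_pdivlMr ?exprn_gt0// -exprMn [`|y| * e]mulrC.
  have ey0 : 0 <= e * `|y| by rewrite mulr_ge0// ltW.
  case: k => [|k]; first by rewrite expr0 mul1r -expR0 ler_expR.
  rewrite [leRHS]mulrC -ler_pdivrMr ?ltr0n ?fact_gt0//.
  by apply: le_trans (expR_ge1Dxn k ey0); rewrite lerDr.
rewrite normrM normrX (ger0_norm (expR_ge0 _)).
have C0 : 0 <= k`!%:R / e ^+ k :> R by rewrite divr_ge0// exprn_ge0// ltW.
set C := _ / _ in pow_le C0 *.
apply: (le_trans (ler_wpM2r (expR_ge0 _) pow_le)).
rewrite -mulrA ler_wpM2l// -expRD.
have : e * `|y| + s * y <= t * y + 2 * e * `|y|.
  have : (s - t) * y <= e * `|y|.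
    by rewrite (le_trans (ler_norm _))// normrM ler_wpM2r.
  by rewrite mulrBl; lra.
rewrite -ler_expR => /le_trans; apply.
have [y0|y0] := ger0P y.
  by rewrite -mulrDl ler_wpDr// expR_ge0.
by rewrite mulrN -mulrBl ler_wpDl// expR_ge0.
Qed.

(** The [k]-th derivative of M on [J], written as an integral. *)
Definition exp_moment {R : realType} (N : R) (rho : {measure set R -> \bar R})
    (k : nat) (t : R) : R :=
  \int[rho]_x ((N * x) ^+ k * expR (t * N * x)).

Section exp_moment.
Context {R : realType} (N : R) (rho : {measure set R -> \bar R}) (J : set R).
Hypothesis openJ : open J.
Hypothesis finJ : forall t, J t -> (\int[rho]_x (expR (t * N * x))%:E < +oo)%E.

Let measurable_integrand k t :
  measurable_fun [set: R] (fun x => (N * x) ^+ k * expR (t * N * x)).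
Proof.
apply: measurable_funM; first by apply: measurable_funX; exact: measurable_funM.
by apply: measurableT_comp => //; exact: measurable_funM.
Qed.

Let integrable_expR t : J t ->
  rho.-integrable [set: R] (EFin \o (fun x => expR (t * N * x))).
Proof.
move=> Jt; apply/integrableP; split.
  apply/measurable_EFinP; apply: measurableT_comp => //; exact: measurable_funM.
by under eq_integral do rewrite /= ger0_norm ?expR_ge0//; exact: finJ.
Qed.

Let dominant (k : nat) (e t x : R) : R :=
  k`!%:R / e ^+ k * (expR ((t + 2 * e) * N * x) + expR ((t - 2 * e) * N * x)).

Let integrable_dominant k e t : J (t + 2 * e) -> J (t - 2 * e) ->
  rho.-integrable [set: R] (EFin \o dominant k e t).
Proof.
move=> Jp Jm.
have -> : EFin \o dominant k e t = (fun x => (k`!%:R / e ^+ k)%:E *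
    (((EFin \o (fun x => expR ((t + 2 * e) * N * x))) \+
     (EFin \o (fun x => expR ((t - 2 * e) * N * x)))) x))%E by [].
by apply: integrableZl => //; apply: integrableD => //; exact: integrable_expR.
Qed.

Let radius t : J t -> exists2 e : R, 0 < e & forall s, `|s - t| <= 2 * e -> J s.
Proof.
move=> Jt; have : nbhs t J by exact: open_nbhs_nbhs.
(* A third of the radius keeps [t + 2 * e] and [t - 2 * e], the exponents of [dominant], inside
   [J]. *)
move=> /nbhs_ballP[r /= r0 rJ]; exists (r / 3); first by rewrite divr_gt0.
move=> s st; apply: rJ; rewrite /ball/= distrC (le_lt_trans st)//.
by lra.
Qed.

Lemma integrable_exp_moment k t : J t ->
  rho.-integrable [set: R] (EFin \o (fun x => (N * x) ^+ k * expR (t * N * x))).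
Proof.
move=> Jt; have [e e0 eJ] := radius t Jt.
apply: (le_integrable _ _ _ (integrable_dominant k e t _ _)) => //.
- by apply/measurable_EFinP; exact: measurable_integrand.
- move=> x _; rewrite lee_fin [leRHS]ger0_norm.
    rewrite /dominant -!(mulrA _ N x); apply: exprn_mul_expR_le => //.
    by rewrite subrr normr0 ltW.
  by rewrite mulr_ge0 ?divr_ge0 ?exprn_ge0 ?addr_ge0 ?expR_ge0// ltW.
- by apply: eJ; rewrite addrC addKr ger0_norm// mulr_ge0// ltW.
- by apply: eJ; rewrite addrC addKr normrN ger0_norm// mulr_ge0// ltW.
Qed.

Lemma is_derive_exp_moment k t : J t ->
  is_derive t 1 (exp_moment N rho k) (exp_moment N rho k.+1 t).
Proof.
move=> Jt; have [e e0 eJ] := radius t Jt.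
pose f s x := (N * x) ^+ k * expR (s * N * x).
have df (s x : R) : is_derive s 1 (f ^~ x) ((N * x) ^+ k.+1 * expR (s * N * x)).
  have -> : f ^~ x = (N * x) ^+ k \*: (expR \o (N * x \*: id)).
    by apply/funext => u; rewrite /f /= /GRing.scale/=; congr (_ * expR _); ring.
  apply: is_derive_eq; rewrite /= /GRing.scale/=.
  rewrite (_ : s * N * x = N * x * s); last by ring.
  by rewrite exprSr mulr1 -mulrA [X in _ * X]mulrC.
have p1f (s x : R) : partial1of2 f s x = (N * x) ^+ k.+1 * expR (s * N * x).
  by rewrite partial1of2E derive_val.
have It : `]t - e, t + e[%classic t by rewrite /= in_itv/= ltrBlDr ltrDl e0.
have sI (s : R) : `]t - e, t + e[%classic s -> `|s - t| <= e.
  by rewrite /= in_itv/= => /andP[a b]; rewrite ler_distl !ltW.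
have IJ (s : R) : `]t - e, t + e[%classic s -> J s.
  by move=> /sI se; apply: eJ; rewrite (le_trans se)//; lra.
have intf (s : R) : `]t - e, t + e[%classic s -> rho.-integrable [set: R] (EFin \o f s).
  by move=> /IJ; exact: integrable_exp_moment.
have derf (s x : R) : `]t - e, t + e[%classic s -> [set: R] x -> derivable (f ^~ x) s 1.
  by move=> _ _; have [] := df s x.
have G0 x : 0 <= dominant k.+1 e t x.
  by rewrite mulr_ge0 ?divr_ge0 ?exprn_ge0 ?addr_ge0 ?expR_ge0// ltW.
(* The exponent is [k.+1] because the derivative in [s] brings down one more factor [N * x]. *)
have intG : rho.-integrable [set: R] (EFin \o dominant k.+1 e t).
  apply: integrable_dominant; apply: eJ.
    by rewrite addrC addKr ger0_norm// mulr_ge0// ltW.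
  by rewrite addrC addKr normrN ger0_norm// mulr_ge0// ltW.
have Gub (s x : R) : `]t - e, t + e[%classic s -> [set: R] x ->
    `|partial1of2 f s x| <= dominant k.+1 e t x.
  move=> /sI se _; rewrite p1f /dominant -!(mulrA _ N x).
  by apply: exprn_mul_expR_le.
apply: DeriveDef.
  exact: (derivable_under_integral measurableT It intf derf G0 intG Gub).
rewrite -derive1E.
rewrite (differentiation_under_integral measurableT It intf derf G0 intG Gub).
by apply: eq_Rintegral => x _; rewrite p1f.
Qed.

Lemma derive1n_exp_moment k t : J t ->
  derive1n k (exp_moment N rho 0) t = exp_moment N rho k t.
Proof.
elim: k t => [//|k IH] t Jt.
rewrite derive1nS derive1E.
rewrite -[RHS](@derive_val _ _ _ _ _ _ _ (is_derive_exp_moment k t Jt)).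
apply: near_eq_derive; near=> s; apply: IH.
by near: s; exact: open_nbhs_nbhs.
Unshelve. all: by end_near. Qed.

End exp_moment.

(** * Positive definiteness of the moment matrix *)

Lemma hdet_exp_moment_gt0 (R : realType) (N : R) (rho : {measure set R -> \bar R})
    (J : set R) (k : nat) (t : R) :
  0 < N -> ~ finite_set (msupport rho) -> open J ->
  (forall t, J t -> (\int[rho]_x (expR (t * N * x))%:E < +oo)%E) ->
  J t -> 0 < hdet (fun i => exp_moment N rho i t) id id k.
Proof.
move=> N0 infsupp oJ finJ Jt; apply: hdet_gt0 => {}k v v0.
(* [p] has coefficients [v], so the quadratic form of [v] is the integral of p(Nx)^2 e^(tNx), that
   is, of [g]. *)
pose p : {poly R} := rVpoly v^T.
have p0 : p != 0.
  apply: contra v0 => /eqP pv; rewrite -trmx_eq0 -[v^T]rVpolyK -/p pv.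
  by apply/eqP/rowP => i; rewrite !mxE coef0.
pose g x := p.[N * x] ^+ 2 * expR (t * N * x).
have g0 x : 0 <= g x by rewrite mulr_ge0 ?sqr_ge0 ?expR_ge0.
pose h (ij : 'I_k * 'I_k) x : \bar R :=
  ((v ij.1 0 * v ij.2 0)%:E * ((N * x) ^+ (ij.1 + ij.2) * expR (t * N * x))%:E)%E.
have inth ij : rho.-integrable [set: R] (h ij).
  by apply: integrableZl => //; exact: (integrable_exp_moment N rho J).
have gh x : (g x)%:E = (\sum_ij h ij x)%E.
  rewrite /h; under eq_bigr do rewrite -EFinM.
  rewrite sumEFin; congr EFin.
  rewrite /g (_ : p.[N * x] = \sum_(i < k) v i 0 * (N * x) ^+ i); last first.
    rewrite horner_poly; apply: eq_bigr => i _.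
    by rewrite valK mxE.
  rewrite expr2 big_distrlr/= pair_big/= mulr_suml; apply: eq_bigr => ij _.
  by rewrite exprD; ring.
have intg : rho.-integrable [set: R] (EFin \o g).
  rewrite (_ : EFin \o g = fun x => (\sum_ij h ij x)%E); last exact/funext.
  exact: integrable_sum.
have -> : (v^T *m (\matrix_(i < k, j < k) exp_moment N rho (i + j) t) *m v) 0 0 =
    \int[rho]_x g x.
  rewrite /Rintegral; under eq_integral do rewrite gh.
  rewrite integral_sum//.
  under [in RHS]eq_bigr => ij _.
    rewrite integralZl//; last exact: (integrable_exp_moment N rho J).
    rewrite -(fineK (integrable_fin_num _
      (integrable_exp_moment N rho J oJ finJ (ij.1 + ij.2) t Jt)))//.
    rewrite -EFinM. over.
  rewrite sumEFin/= -(pair_big xpredT xpredT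
    (fun i j : 'I_k => v i 0 * v j 0 * exp_moment N rho (i + j) t))/=.
  rewrite mxE exchange_big/=; apply: eq_bigr => j _.
  rewrite mxE mulr_suml; apply: eq_bigr => i _.
  by rewrite !mxE; ring.
rewrite lt_def Rintegral_ge0 ?andbT//.
apply/negP => /eqP intg0.
have [A [mA A0 gA]] : ae_eq rho setT (EFin \o g) (cst 0%E).
  apply/ae_eq_integral_abs => //; first exact: measurable_int intg.
  under eq_integral do rewrite /= ger0_norm//.
  by rewrite -[LHS]fineK ?integrable_fin_num// -/(Rintegral _ _ _) intg0.
(* If p(Nx) were nonzero, [g] would be nonzero on a ball around [x]; that ball would lie in the null
   set [A], contrary to [x] being in the support. *)
have root_supp x : msupport rho x -> root p (N * x).
  move=> suppx; apply/negPn/negP => px.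
  have : nbhs x [set y | g y != 0].
    have qE y : (p \Po (N%:P * 'X)).[y] = p.[N * y].
      by rewrite horner_comp hornerM hornerC hornerX.
    have := @continuous_horner R (p \Po (N%:P * 'X)) x.
    move=> /cvgr_neq0; rewrite qE => /(_ px); apply: filterS => y /=; rewrite qE => py.
    by rewrite /g mulf_neq0 ?sqrf_eq0// gt_eqF// expR_gt0.
  move=> /nbhs_ballP[e /= e0 eg].
  have := suppx e e0; apply/negP; rewrite -leNgt -A0 le_measure ?inE//.
    exact: measurable_ball.
  by move=> y /eg gy; apply: gA => /= /(_ I)[]; exact/eqP.
(* At least [size p] support points, scaled by [N], give more distinct roots than the degree of [p]
   allows. *)
have [B Bsupp] := infinite_set_fset (size p) infsupp.
apply/negP; rewrite -ltnNge.
rewrite -(size_map (fun x => N * x)); apply: max_poly_roots => //.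
  by apply/allP => _ /mapP[x xB ->]; apply: root_supp; exact: Bsupp.
by rewrite map_inj_uniq ?finmap.fset_uniq//; exact/mulfI/lt0r_neq0.
Qed.

(** * Assembly for the moment generating function *)

Theorem theorem1 (R : realType) (N : R) (rho : {measure set R -> \bar R})
    (a b : \bar R) :
  0 < N ->
  ~ finite_set (msupport rho) ->
  (a < b)%E ->
  (forall t : R, (a < t%:E < b)%E ->
     (\int[rho]_x (expR (t * N * x))%:E < +oo)%E) ->
  forall (n : nat) (t : R), (1 <= n)%N -> (a < t%:E < b)%E ->
    lanczosL N (mgfM N rho) n t =
      N^-1 * \sum_(1 <= j < n.+1)
               ((j%:R / N) * derive1n 2 ((@ln R) \o lanczosL N (mgfM N rho) (n - j)%N) t).
Proof.
move=> N0 infsupp _ finJ n t n1 Jt.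
pose J := [set s : R | (a < s%:E < b)%E].
have oJ : open J.
  have -> : J = [set s | (a < s%:E)%E] `&` [set s | (s%:E < b)%E].
    by apply/seteqP; split => s /= /andP.
  by apply: openI; [exact: open_ereal_gt|exact: open_ereal_lt].
(* The integrands coincide pointwise, so this equality of functions holds outside [J] too and can be
   rewritten under the derivatives. *)
have ME : mgfM N rho = exp_moment N rho 0.
  apply/funext => s; rewrite /mgfM /exp_moment /Rintegral.
  by under [in RHS]eq_integral do rewrite expr0 mul1r.
rewrite ME.
apply: (lanczos_toda R J (exp_moment N rho) N n t) => //.
- by move=> k s; exact: is_derive_exp_moment.
- by move=> k s; exact: hdet_exp_moment_gt0.
- by move=> k s; exact: derive1n_exp_moment.
Qed.
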